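(* Let $k$ be an algebraically closed field of characteristic $p>0$ and let $d\geq 4$ be an integer not divisible by $p$. Let $e$ be the smallest positive integer such that $d$ divides $2p^e-2$. Then there exists a reduced homogeneous polynomial of degree $d$ in $k[x,y]$ whose $F$-pure threshold is $\langle \frac{2}{d}\rangle_L$ for some positive integer $L\leq e$.
   Context: A nonzero homogeneous polynomial is reduced if it has no repeated irreducible factors. For a nonzero homogeneous $f\in k[x,y]$ of positive degree, $\mathrm{fpt}(f)=\sup\{N/p^e : f^N\notin (x^{p^e},y^{p^e})\}=\inf\{N/p^e: f^N\in(x^{p^e},y^{p^e})\}$. For a real number $0<\lambda\le 1$, write its unique non-terminating base $p$ expansion $\lambda=\sum_{i\ge1}\alpha_i/p^i$ (integers $0\le\alpha_i\le p-1$, the sequence $(\alpha_i)$ not eventually zero). Then $\langle\lambda\rangle_e:=\sum_{i=1}^e\alpha_i/p^i$; equivalently $\langle \lambda\rangle_e=N_e/p^e$ with $N_e$ the unique integer such that $0<\lambda-N_e/p^e\le 1/p^e$. *)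

(* Defs.v *)
From mathcomp Require Import all_boot all_order all_algebra.
From mathcomp Require Import mpoly.
From mathcomp Require Import boolp classical_sets reals topology normedtype
  sequences.

Set Implicit Arguments.
Unset Strict Implicit.
Unset Printing Implicit Defensive.

Import Order.TTheory GRing.Theory Num.Theory.
Import numFieldNormedType.Exports.

Local Open Scope classical_set_scope.
Local Open Scope ring_scope.

Definition irreducible_elt (A : idomainType) (g : A) : Prop :=
  [/\ g != 0, g \isn't a GRing.unit &
      forall a b : A, g = a * b -> a \is a GRing.unit \/ b \is a GRing.unit].

Definition reduced (A : idomainType) (f : A) : Prop :=
  f != 0 /\
  forall g : A, irreducible_elt g -> ~ exists h : A, f = g ^+ 2 * h.

(* Membership in the ideal (x^q, y^q), where x = 'X_0 and y = 'X_1. *)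
Definition in_xy_ideal (k : fieldType) (q : nat) (g : {mpoly k[2]}) : Prop :=
  exists a b : {mpoly k[2]}, g = a * 'X_0 ^+ q + b * 'X_1 ^+ q.

(* Meaningful for f homogeneous of positive degree over a field of
   characteristic p; for other f the set may be empty or unbounded, in which
   case [sup] returns a default value. *)
Definition fpt (R : realType) (k : fieldType) (p : nat) (f : {mpoly k[2]}) : R :=
  sup [set x : R | exists N e : nat,
         x = N%:R / p%:R ^+ e /\ ~ in_xy_ideal (p ^ e)%N (f ^+ N)].

(* Digits are indexed from 0: [a i] is the coefficient of p^-(i+1). *)
Definition nonterminating_expansion (R : realType) (p : nat) (lambda : R)
    (a : nat -> nat) : Prop :=
  [/\ forall i, (a i < p)%N,
      forall n, exists2 i, (n <= i)%N & a i != 0%N &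
      series (fun i => (a i)%:R / p%:R ^+ i.+1 : R) @ \oo --> lambda].

(* For 1 < p and 0 < lambda <= 1 the expansion exists and is unique, so the
   default value of [xget] is irrelevant. *)
Definition digits (R : realType) (p : nat) (lambda : R) : nat -> nat :=
  xget (fun=> 0%N) [set a | nonterminating_expansion p lambda a].

Definition truncation (R : realType) (p e : nat) (lambda : R) : R :=
  \sum_(i < e) (digits p lambda i)%:R / p%:R ^+ i.+1.

(* Main.v *)
(* Let q = p^e and d N = 2q - 2. Up to scalar, the coefficient of (xy)^(q-1) is
   the only obstruction to f^N lying in (x^q, y^q), so it suffices to find a
   reduced f for which it vanishes. Then let L be least positive with f^n in
   (x^(p^L), y^(p^L)) for n the numerator of <2/d>_L; L is at most e. This bounds
   fpt f above by <2/d>_L. For the lower bound, if f^(n+1) but not f^n lies in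
   (x^q, y^q) and p does not divide n + 1, then f^n f_x and f^n f_y lie there too;
   as f is reduced and p does not divide d, (f_x, f_y) contains all forms of
   degree 2d - 3, which forces d (n + 2) >= 2q + 2. Hence membership cannot start
   too early at any level beyond L.

   To find f: the coefficient of (xy)^(q-1) in f^N is a polynomial in the d lines
   of f. If it is nonzero at some form with a repeated line, then it is nonzero at
   l_j * prod_i l_i for every j and generic l_1, ..., l_(d-1); so, as a polynomial
   in t of degree N, its value at (prod_i l_i) (x - t y) has a root t, and no root
   makes x - t y proportional to some l_j. The form x^r y^r or x^r y^r (x + y) has
   nonzero coefficient unless d is odd and 'C(N, N/2) = 0 in k, and then
   x^d - y^d works. *)
Require Import Defs.
From mathcomp Require Import all_boot all_order all_algebra.
From mathcomp Require Import mpoly reals perm separable cyclotomic.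
From mathcomp Require Import boolp classical_sets topology normedtype sequences.
From mathcomp Require Import zify ring.
Set Implicit Arguments.
Unset Strict Implicit.
Unset Printing Implicit Defensive.
Import Order.TTheory GRing.Theory Num.Theory.
Import numFieldNormedType.Exports.
Local Open Scope ring_scope.

(** * Binary forms and Frobenius powers *)

(* A binary form of degree [D] is represented by its dehomogenization [G] at
   y = 1, and [form_in D q G] says that the form lies in (x^q, y^q); [D < q + j]
   is [D - j < q] without truncated subtraction. *)
Definition form_in (k : fieldType) (D q : nat) (G : {poly k}) : Prop :=
  forall j : nat, (j < q)%N -> (D < q + j)%N -> G`_j = 0.

(** The size bound says that [H] comes from a form of degree [E]. In the coefficient sum, an index
    [i] with [E < j - i] kills [H], and any other satisfies [D < q + i]. *)
Lemma form_inMr (k : fieldType) (D E q : nat) (G H : {poly k}) :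
  form_in D q G -> (size H <= E.+1)%N -> form_in (D + E) q (G * H).
Proof.
move=> GI sH j jq Dj; rewrite coefM big1 // => i _.
have ij := ltn_ord i.
have [Eij|ijE] := ltnP E (j - i).
  by rewrite (nth_default _ (leq_trans sH Eij)) mulr0.
by rewrite GI ?mul0r //; lia.
Qed.

Lemma form_inD (k : fieldType) (D q : nat) (G H : {poly k}) :
  form_in D q G -> form_in D q H -> form_in D q (G + H).
Proof. by move=> GI HI j jq Dj; rewrite coefD GI ?HI ?addr0. Qed.

Lemma size_exp_leq (k : fieldType) (d n : nat) (F : {poly k}) :
  (size F <= d.+1)%N -> (size (F ^+ n) <= (d * n).+1)%N.
Proof.
move=> sF; apply: leq_trans (size_poly_exp_leq _ _) _.
by rewrite ltnS leq_mul2r -subn1 leq_subLR sF orbT.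
Qed.

Lemma form_in_exp_leq (k : fieldType) (d q m n : nat) (F : {poly k}) :
    (size F <= d.+1)%N -> (m <= n)%N ->
  form_in (d * m) q (F ^+ m) -> form_in (d * n) q (F ^+ n).
Proof.
move=> sF mn Fm; rewrite -(subnKC mn) exprD mulnDr; apply: form_inMr => //.
exact: size_exp_leq.
Qed.

Lemma exprX_pchar (k : fieldType) (p : nat) (F : {poly k}) (t : nat) :
    p \in [pchar k] ->
  F ^+ (p ^ t) = \sum_(i < size F) (F`_i ^+ (p ^ t)) *: 'X^(i * p ^ t).
Proof.
move=> hp; have nP : [pchar {poly k}].-nat (p ^ t)%N.
  rewrite (eq_pnat _ (@pchar_poly k)) (eq_pnat _ (pcharf_eq hp)).
  by rewrite pnatX pnat_id ?(pcharf_prime hp).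
rewrite -{1}[F]coefK poly_def.
have exprDsum (I : Type) (s : seq I) (G : I -> {poly k}) :
    (\sum_(i <- s) G i) ^+ (p ^ t) = \sum_(i <- s) G i ^+ (p ^ t).
  elim: s => [|i s IH]; first by rewrite !big_nil expr0n expn_eq0;
    case: p hp {nP} => // /pcharf_prime.
  by rewrite !big_cons exprDn_pchar // IH.
by rewrite exprDsum; apply: eq_bigr => i _; rewrite exprZn -exprM.
Qed.

Lemma coef_exp_pchar (k : fieldType) (p : nat) (F : {poly k}) (t j : nat) :
    p \in [pchar k] ->
  (F ^+ (p ^ t))`_j = if (p ^ t %| j)%N then F`_(j %/ p ^ t) ^+ (p ^ t) else 0.
Proof.
move=> hp; have pt_gt0 : (0 < p ^ t)%N by rewrite expn_gt0 prime_gt0 ?(pcharf_prime hp).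
rewrite (exprX_pchar _ _ hp) coef_sum.
under eq_bigr => i _ do rewrite coefZ coefXn.
case: ifP => [/dvdnP[i ->]|ndvd].
  rewrite mulnK //; have [Fi|iF] := ltnP i (size F).
    rewrite (bigD1 (Ordinal Fi)) //= eqxx mulr1 big1 ?addr0 // => l li.
    by rewrite eqn_pmul2r // eq_sym -val_eqE in li *; rewrite (negPf li) mulr0.
  rewrite nth_default // expr0n gtn_eqF // big1 // => l _.
  by rewrite eqn_pmul2r // gtn_eqF ?mulr0 // (leq_trans (ltn_ord l)).
rewrite big1 // => l _; case: eqP => [jE|_]; last by rewrite mulr0.
by rewrite jE dvdn_mull in ndvd.
Qed.

(** Frobenius neither creates nor loses membership: [G ^+ (p ^ t)] lives at multiples of [p ^ t],
    its coefficients there are powers of those of [G], and both index bounds scale. *)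
Lemma form_in_exp_pchar (k : fieldType) (p : nat) (D q t : nat) (G : {poly k}) :
    p \in [pchar k] ->
  form_in (D * p ^ t) (q * p ^ t) (G ^+ (p ^ t)) <-> form_in D q G.
Proof.
move=> hp; have pt_gt0 : (0 < p ^ t)%N by rewrite expn_gt0 prime_gt0 ?(pcharf_prime hp).
split=> GI j jq Dj.
  have := GI (j * p ^ t)%N; rewrite -mulnDl !ltn_pmul2r // => /(_ jq Dj) /eqP.
  by rewrite coef_exp_pchar // dvdn_mull // mulnK // expf_eq0 => /andP[_ /eqP].
rewrite coef_exp_pchar //; case: ifP => // /dvdnP[i jE].
rewrite jE -mulnDl !ltn_pmul2r // in jq Dj.
by rewrite jE mulnK // GI // expr0n gtn_eqF.
Qed.

(* The degree bounds are those of the isomorphism k[x,y]_(s-n)^2 -> k[x,y]_s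
   given by two coprime forms of degree [n]; [size G = n.+1] excludes a common
   zero at infinity. *)
Lemma Bezout_size (k : fieldType) (n s : nat) (G H T : {poly k}) :
    coprimep G H -> size G = n.+1 -> (size H <= n.+1)%N ->
    (2 * n <= s.+1)%N -> (size T <= s.+1)%N ->
  exists u v : {poly k},
    [/\ T = u * G + v * H, (size u <= (s - n).+1)%N & (size v <= (s - n).+1)%N].
Proof.
move=> /Bezout_eq1_coprimepP[[a b] /= abE] sG sH ns sT.
have G0 : G != 0 by rewrite -size_poly_gt0 sG.
(* Reducing the cofactor of [H] modulo [G] bounds [v]; then [u * G = T - v * H] bounds [u]. *)
pose v : {poly k} := (T * b) %% G; pose u : {poly k} := T * a + (T * b) %/ G * H.
have TE : T = u * G + v * H.
  rewrite -[LHS]mulr1 -abE mulrDr !mulrA {1}(divp_eq (T * b) G) /u -/v.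
  by ring.
have sv : (size v <= n)%N by rewrite -ltnS -sG ltn_modp.
move: sv TE; clearbody u v => sv TE.
exists u, v; split => //; last first.
  by apply: leq_trans sv _; lia.
have suG : (size (u * G)%R <= s.+1)%N.
  have -> : u * G = T - v * H by rewrite TE addrK.
  apply: leq_trans (size_polyD _ _) _; rewrite geq_max sT size_polyN.
  apply: leq_trans (size_polyMleq _ _) _; rewrite -subn1 leq_subLR.
  by apply: leq_trans (leq_add sv sH) _; lia.
have [->|u0] := eqVneq u 0; first by rewrite size_poly0.
move: suG; rewrite size_mul // sG addnS /= => suG.
apply: (@leq_trans (s.+1 - n)); last lia.
by rewrite leq_subRL ?(addnC n) //; lia.
Qed.

(** By Euler's relation x f_x + y f_y = d f, the second polynomial is f_y at y = 1. *)
Lemma coprime_partials (k : fieldType) (d : nat) (F : {poly k}) :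
    (d%:R : k) != 0 -> coprimep F F^`() ->
  coprimep F^`() (d%:R *: F - 'X * F^`()).
Proof.
by move=> d0 cF; rewrite addrC -mulNr coprimep_addl_mul coprimepZr // coprimep_sym.
Qed.

(* Differentiating f^(n+1) in (x^q, y^q) gives f^n f_x, f^n f_y in (x^q, y^q),
   while (f_x, f_y) contains every form of degree at least 2d - 3; so f^n
   kills the socle degree 2q - 2 unless d n is large. *)
Lemma exp_gap (k : fieldType) (p d m n : nat) (F : {poly k}) :
    p \in [pchar k] -> (2 < d)%N -> ~~ (p %| d)%N ->
    size F = d.+1 -> coprimep F F^`() -> (0 < m)%N -> ~~ (p %| n.+1)%N ->
    form_in (d * n.+1) (p ^ m) (F ^+ n.+1) ->
    ~ form_in (d * n) (p ^ m) (F ^+ n) ->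
  (2 * p ^ m + 2 <= d * n.+2)%N.
Proof.
move=> hp d3 pd sF cF m0 pn FI; apply: contra_notT; rewrite -ltnNge => dn j0 j0q dj0.
set q := (p ^ m)%N in dn FI j0q dj0 *.
have q0 : (q%:R : k) = 0 by apply/eqP; rewrite -(dvdn_pcharf hp) dvdn_exp.
have d0 : (d%:R : k) != 0 by rewrite -(dvdn_pcharf hp).
have n0 : (n.+1%:R : k) != 0 by rewrite -(dvdn_pcharf hp).
pose H : {poly k} := d%:R *: F - 'X * F^`().
(* [dF] and [HE] express f^n f_x and f^n f_y as the partial derivatives of f^(n+1) divided by n +
   1. *)
have dF j : ((F ^+ n * F^`())`_j) = j.+1%:R * (F ^+ n.+1)`_j.+1 / n.+1%:R.
  rewrite mulr_natl -coef_deriv deriv_exp /= coefMn mulrC.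
  by rewrite -[_`_j *+ _]mulr_natr mulfK.
have HE j : (F ^+ n * H)`_j = ((d * n.+1)%:R - j%:R) * (F ^+ n.+1)`_j / n.+1%:R.
  rewrite /H mulrBr -scalerAr -exprSr mulrCA coefB coefZ coefXM.
  case: j => [|j] /=; first by rewrite !subr0 natrM mulrAC mulfK.
  by rewrite dF natrM !mulrBl [X in _ = X - _]mulrAC mulfK.
(* The hypothesis on f^(n+1) misses only [j.+1 = q], where the factor [j.+1] vanishes in [k]. For
   [FH] it misses only d (n + 1) - j = q, and that factor vanishes too. *)
have FF' : form_in (d * n + d.-1) q (F ^+ n * F^`()).
  move=> j jq dj; rewrite dF; have [jq1|/eqP jq1] := eqVneq j.+1 q.
    by rewrite jq1 q0 !mul0r.
  rewrite FI ?mulr0 ?mul0r //; lia.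
have FH : form_in (d * n + d.-1) q (F ^+ n * H).
  move=> j jq dj; rewrite HE; have [->|/eqP jq1] := eqVneq (d * n.+1)%N (q + j)%N.
    by rewrite natrD q0 add0r subrr !mul0r.
  rewrite FI ?mulr0 ?mul0r //; lia.
have sF' : size F^`() = d.-1.+1.
  rewrite prednK; last lia.
  apply/eqP; rewrite eqn_leq -ltnS -{1}sF lt_size_deriv -?size_poly_gt0 ?sF //=.
  have : F^`()`_d.-1 != 0.
    rewrite coef_deriv prednK; last lia.
    rewrite -mulr_natr mulf_neq0 //; have := lead_coefE F.
    by rewrite sF /= => <-; rewrite lead_coef_eq0 -size_poly_gt0 sF.
  rewrite -[X in (X <= _)%N]prednK; last lia.
  by apply: contraR; rewrite -leqNgt => /leq_sizeP->.
have sH : (size H <= d.-1.+1)%N.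
  rewrite prednK; last lia.
  apply/leq_sizeP => j dj; rewrite coefB coefZ coefXM.
  case: j dj => [|j] dj; first lia.
  rewrite /= coef_deriv; have [->|jd] := eqVneq j.+1 d.
    by rewrite mulr_natl subrr.
  by rewrite nth_default ?sF ?mulr0 ?mul0rn ?subr0 //; lia.
(* The degree missing up to the socle degree 2q - 2. The negated conclusion amounts to 2 (d - 1) <=
   s + 1, as [Bezout_size] requires. *)
pose s := (2 * q - 2 - d * n)%N.
have q_gt0 : (0 < q)%N by lia.
(* Multiplication by x^(q-1-j0), completed by a power of y to degree [s], moves coefficient [j0] to
   the socle monomial (xy)^(q-1). *)
have js : (q.-1 - j0 <= s)%N by rewrite /s; lia.
have [||u [v [XE su sv]]] := @Bezout_size k d.-1 s F^`() H 'X^(q.-1 - j0)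
    (coprime_partials d0 cF) sF' sH.
- by rewrite /s; lia.
- by rewrite size_polyXn ltnS.
have sE : (2 * q - 2)%N = (d * n + d.-1 + (s - d.-1))%N.
  by rewrite /s; move: (d * n)%N (d * n.+2)%N (mulnS d n.+1) (mulnS d n) dn d3;
    clear; lia.
have top : form_in (2 * q - 2) q (F ^+ n * 'X^(q.-1 - j0)).
  rewrite sE XE (mulrC u) (mulrC v) mulrDr 2!mulrA.
  by apply: form_inD; apply: form_inMr.
have j0q1 : (j0 <= q.-1)%N by rewrite -ltnS prednK.
have <- : (F ^+ n * 'X^(q.-1 - j0))`_q.-1 = (F ^+ n)`_j0.
  by rewrite coefMXn ltnNge leq_subr /= subKn.
by apply: top; move: q_gt0; clear; case: q => // q _ /=; lia.
Qed.

(** If membership held at [M], take the least n >= p a with membership. Frobenius excludes n = p a;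
    otherwise p a < n < p a + p, so p does not divide n, and [exp_gap] at n - 1 contradicts the
    degree bound. *)
Lemma exp_step (k : fieldType) (p d m a M : nat) (F : {poly k}) :
    p \in [pchar k] -> (2 < d)%N -> ~~ (p %| d)%N ->
    size F = d.+1 -> coprimep F F^`() ->
    ~ form_in (d * a) (p ^ m) (F ^+ a) ->
    (p * a <= M < p * a + p)%N -> (d * M.+1 < 2 * p ^ m.+1 + 2)%N ->
  ~ form_in (d * M) (p ^ m.+1) (F ^+ M).
Proof.
move=> hp d3 pd sF cF aI /andP[paM Mpa] dM MI.
pose P n := (p * a <= n)%N && `[< form_in (d * n) (p ^ m.+1) (F ^+ n) >].
have exP : exists n, P n by exists M; rewrite /P paM; apply/asboolP.
case: (ex_minnP exP) => n /andP[pan /asboolP nI] nmin.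
have nM : (n <= M)%N by apply: nmin; rewrite /P paM; apply/asboolP.
have [npa|npa] := eqVneq n (p * a)%N.
  apply: aI; rewrite -(form_in_exp_pchar (d * a) (p ^ m) 1 (F ^+ a) hp).
  by rewrite expn1 -exprM -expnSr -mulnA (mulnC a) -npa.
case: n => [|n] in pan nI nmin nM npa *.
  by rewrite leqn0 in pan; rewrite eq_sym pan in npa.
have pan' : (p * a <= n)%N by rewrite -ltnS ltn_neqAle eq_sym npa.
have nI' : ~ form_in (d * n) (p ^ m.+1) (F ^+ n).
  by move=> nI'; have := nmin n; rewrite /P pan' ltnn; move=> /(_ (asboolT nI')).
have pn : ~~ (p %| n.+1)%N.
  apply/negP => /dvdnP[c nE].
  have := leq_ltn_trans nM Mpa; move: pan'; rewrite -ltnS -mulnSr nE !(mulnC p).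
  by rewrite !ltn_mul2r => /andP[_ ac] /andP[_]; rewrite ltnS leqNgt ac.
have := exp_gap hp d3 pd sF cF (ltn0Sn m) pn nI nI'.
apply/negP; rewrite -ltnNge; apply: leq_ltn_trans dM.
by rewrite leq_mul2l ltnS nM orbT.
Qed.

(** * Truncations of 2/d *)

(* The largest [n] with n/p^s < 2/d; the inequality is strict because the
   expansion defining the truncation is non-terminating. *)
Definition trunc_num (p d s : nat) : nat := ((2 * p ^ s).-1 %/ d)%N.

Lemma trunc_num_lt (p d s : nat) :
  (0 < p)%N -> (d * trunc_num p d s < 2 * p ^ s)%N.
Proof.
move=> p0; have : (0 < 2 * p ^ s)%N by rewrite muln_gt0 expn_gt0 p0.
by rewrite /trunc_num; case: (2 * p ^ s)%N => // q _; rewrite ltnS mulnC leq_trunc_div.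
Qed.

Lemma trunc_num_ge (p d s : nat) :
  (0 < d)%N -> (2 * p ^ s <= d * (trunc_num p d s).+1)%N.
Proof.
move=> d0; have := ltn_ceil (2 * p ^ s).-1 d0.
by rewrite /trunc_num (mulnC d); case: (2 * p ^ s)%N.
Qed.

Lemma trunc_num_eq (p d s n : nat) :
  (d * n < 2 * p ^ s)%N -> (2 * p ^ s <= d * n.+1)%N -> trunc_num p d s = n.
Proof.
move=> lt ge; rewrite /trunc_num.
have d0 : (0 < d)%N by case: d lt ge => //; rewrite !mul0n; case: (2 * p ^ s)%N.
apply/eqP; rewrite eqn_leq -ltnS ltn_divLR // leq_divRL // !(mulnC _ d).
by move: lt ge; case: (2 * p ^ s)%N => //= q; rewrite ltnS => -> ->.
Qed.

Lemma trunc_num_step (p d s : nat) : (0 < p)%N -> (0 < d)%N ->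
  (p * trunc_num p d s <= trunc_num p d s.+1 < p * trunc_num p d s + p)%N.
Proof.
move=> p0 d0.
have lt := trunc_num_lt d s p0; have ge := trunc_num_ge p s d0.
have lt' := trunc_num_lt d s.+1 p0; have ge' := trunc_num_ge p s.+1 d0.
rewrite expnS mulnCA in lt' ge'; apply/andP; split.
  have := leq_trans _ ge'; rewrite -(ltn_pmul2l p0) mulnCA in lt.
  by move=> /(_ _ lt); rewrite ltn_pmul2l.
rewrite -mulnSr -(ltn_pmul2l d0) (leq_trans lt') //.
by rewrite [X in (_ <= X)%N]mulnCA leq_pmul2l.
Qed.

(** With N = [trunc_num p d L.+1], the quotients n / p^(L+1+s) tend to N / p^(L+1) from below, so
    these non-memberships give the lower bound on the threshold. In the induction on [s], the degree
    bound of [exp_step] comes from d N < 2 p^(L+1). *)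
Lemma exp_trunc_lower (k : fieldType) (p d L s : nat) (F : {poly k}) :
    p \in [pchar k] -> (2 < d)%N -> ~~ (p %| d)%N ->
    size F = d.+1 -> coprimep F F^`() ->
    ~ form_in (d * trunc_num p d L) (p ^ L) (F ^+ trunc_num p d L) ->
    form_in (d * trunc_num p d L.+1) (p ^ L.+1) (F ^+ trunc_num p d L.+1) ->
  let n := (p ^ s * trunc_num p d L.+1).-1 in
  ~ form_in (d * n) (p ^ (L.+1 + s)) (F ^+ n).
Proof.
move=> hp d3 pd sF cF nI yI /=.
have p0 : (0 < p)%N := prime_gt0 (pcharf_prime hp).
have d0 : (0 < d)%N by apply: leq_trans d3.
have /andP[ge lt] := trunc_num_step L p0 d0.
have N0 : (0 < trunc_num p d L.+1)%N.
  rewrite lt0n; apply/eqP => N0; move: yI; rewrite N0 muln0 expr0.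
  move=> /(_ 0%N); rewrite addn0 expn_gt0 p0 => /(_ isT isT) /eqP.
  by rewrite coef1 oner_eq0.
have dN := trunc_num_lt d L.+1 p0.
set N := trunc_num p d L.+1 in ge lt N0 dN yI *.
elim: s => [|s IH].
  rewrite mul1n addn0; apply: (exp_step hp d3 pd sF cF nI); last first.
    by rewrite prednK //; lia.
  (* Equality would, by Frobenius, turn membership at level L + 1 into membership at level L. *)
  have [NE|NE] := eqVneq N (p * trunc_num p d L)%N.
    case: nI; rewrite -(form_in_exp_pchar _ _ 1 _ hp).
    by rewrite expn1 -exprM -expnSr -mulnA (mulnC _ p) -NE.
  by apply/andP; split; lia.
(* The new exponent is the last one of its block: p^(s+1) N - 1 = p (p^s N - 1) + (p - 1). *)
rewrite addnS; apply: (exp_step hp d3 pd sF cF IH); last first.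
  rewrite prednK ?muln_gt0 ?expn_gt0 ?p0 //.
  have -> : ((L.+1 + s).+1 = s.+1 + L.+1)%N by lia.
  rewrite expnD mulnCA [X in (_ < X + _)%N]mulnCA.
  by rewrite ltn_addr // ltn_pmul2l ?expn_gt0 ?p0.
have : (0 < p ^ s * N)%N by rewrite muln_gt0 expn_gt0 p0.
by rewrite expnS -mulnA; case: (p ^ s * N)%N => // x _; rewrite mulnSr /=; lia.
Qed.

(** * Non-terminating expansions and their truncations *)

Lemma expansion_trunc (R : realType) (p : nat) (lambda : R) (a : nat -> nat)
    (n : nat) :
    (0 < p)%N -> nonterminating_expansion p lambda a ->
    let S := \sum_(i < n) (a i)%:R / p%:R ^+ i.+1 in
  S < lambda <= S + (p%:R ^+ n)^-1.
Proof.
move=> p0 [ap anz acv] /=.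
have p0R : 0 < p%:R :> R by rewrite ltr0n.
set u : R^nat := (fun i => _) in acv.
have u0 i : 0 <= u i by rewrite divr_ge0 ?exprn_ge0 ?ler0n.
have uS m : series u m.+1 = series u m + u m by rewrite !seriesEnat /= big_nat_recr.
have <- : series u n = \sum_(i < n) (a i)%:R / p%:R ^+ i.+1.
  by rewrite seriesEnat /= big_mkord.
have umono : nondecreasing_seq (series u).
  by apply/nondecreasing_seqP => m; rewrite uS lerDl.
have ucvg : cvgn (series u) by apply/cvg_ex; exists lambda.
have limE : limn (series u) = lambda by apply: cvg_lim.
apply/andP; split.
  have [i ni ai] := anz n.
  apply: (@lt_le_trans _ _ (series u i.+1)).
    rewrite uS; apply: (@le_lt_trans _ _ (series u i)); first exact: umono.
    by rewrite ltrDl divr_gt0 ?exprn_gt0 // ltr0n lt0n.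
  by rewrite -limE; apply: nondecreasing_cvgn_le.
rewrite -limE; apply: limr_le => //; exists n => // m /= nm.
(* Partial sum plus p^-m is nonincreasing in m, because each digit is at most p - 1. *)
suff h : series u m + (p%:R ^+ m)^-1 <= series u n + (p%:R ^+ n)^-1.
  by apply: le_trans h; rewrite lerDl invr_ge0 exprn_ge0 ?ler0n.
elim: m nm => [|m IH]; first by rewrite leqn0 => /eqP ->.
rewrite leq_eqVlt => /predU1P[-> //|]; rewrite ltnS => /IH; apply: le_trans.
rewrite uS -addrA lerD2l -[X in _ + X]mul1r /u -mulrDl natr1.
rewrite exprS invfM mulrA ler_pdivrMr ?invr_gt0 ?exprn_gt0 // mulVf ?gt_eqF ?exprn_gt0 //.
by rewrite ler_pdivrMr // mul1r ler_nat.
Qed.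

Lemma trunc_num_bounds (R : realType) (p d s : nat) : (0 < p)%N -> (0 < d)%N ->
  (trunc_num p d s)%:R / p%:R ^+ s < (2 / d%:R : R) <=
    (trunc_num p d s).+1%:R / p%:R ^+ s.
Proof.
move=> p0 d0.
have p0R : 0 < p%:R ^+ s :> R by rewrite exprn_gt0 // ltr0n.
have d0R : 0 < d%:R :> R by rewrite ltr0n.
rewrite ltr_pdivrMr // ler_pdivlMr // mulrAC ltr_pdivlMr // ler_pdivrMr //.
rewrite -natrX -!natrM ltr_nat ler_nat ![(_ * d)%N]mulnC.
by rewrite trunc_num_lt ?trunc_num_ge.
Qed.

Lemma trunc_num_nonterminating (R : realType) (p d : nat) :
    (1 < p)%N -> (1 < d)%N ->
  nonterminating_expansion p (2 / d%:R : R)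
    (fun i => trunc_num p d i.+1 - p * trunc_num p d i)%N.
Proof.
move=> p1 d1; have p0 : (0 < p)%N by apply: ltnW.
have d0 : (0 < d)%N by apply: ltnW.
have p0R : 0 < p%:R :> R by rewrite ltr0n.
have d0R : 0 < d%:R :> R by rewrite ltr0n.
have step i := trunc_num_step i p0 d0.
split=> [i|n|].
- by have /andP[ge lt] := step i; rewrite ltn_subLR.
(* If all digits from [n] on vanish, the positive gap 2 p^i - d [trunc_num p d i] is multiplied by p
   at each level past [n], yet never exceeds d. After d levels this gives p^d <= d. *)
- apply: contrapT => nex.
  have zero i : (n <= i)%N -> trunc_num p d i.+1 = (p * trunc_num p d i)%N.
    move=> ni; have /andP[ge _] := step i; apply/eqP; rewrite eqn_leq ge andbT.
    rewrite -subn_eq0; apply/negP => ne; apply: nex; exists i => //; exact/negP.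
  have gap i : trunc_num p d (n + i) = (p ^ i * trunc_num p d n)%N.
    elim: i => [|i IH]; first by rewrite addn0 mul1n.
    by rewrite addnS zero ?leq_addr // IH expnS mulnA.
  have h1 : (p ^ d * (d * trunc_num p d n).+1 <= p ^ d * (2 * p ^ n))%N.
    by rewrite leq_mul2l (trunc_num_lt d n p0) orbT.
  have := trunc_num_ge p (n + d) d0.
  rewrite gap expnD mulnS (mulnC (p ^ n)%N) mulnCA => /(leq_trans h1).
  by rewrite mulnS [X in (_ <= _ + X)%N]mulnCA leq_add2r leqNgt ltn_expl.
(* The partial sums telescope to [trunc_num p d n] / p^n, which is squeezed between 2/d - p^-n and
   2/d. *)
- have pS n : \sum_(0 <= i < n) (trunc_num p d i.+1 - p * trunc_num p d i)%N%:R
      / p%:R ^+ i.+1 = (trunc_num p d n)%:R / p%:R ^+ n :> R.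
    elim: n => [|n IH].
      by rewrite big_geq // /trunc_num divn_small ?mul0r.
    rewrite big_nat_recr //= IH; have /andP[ge _] := step n.
    rewrite natrB // natrM mulrBl exprS invfM.
    rewrite [X in _ + (_ - X)]mulrACA divff ?gt_eqF // mul1r.
    by rewrite addrC subrK.
  have half_lt : `|(p%:R : R)^-1| < 1.
    by rewrite ger0_norm ?invr_ge0 ?ler0n // invf_lt1 ?ltr1n.
  have cv0 := cvg_expr half_lt.
  have cvl : ((fun n => 2 / d%:R - (p%:R : R)^-1 ^+ n) @ \oo --> (2 / d%:R : R))%classic.
    by rewrite -[X in (_ --> X)%classic]subr0; apply: cvgB => //; apply: cvg_cst.
  apply: squeeze_cvgr cvl (cvg_cst _); apply: nearW => n /=.
  rewrite seriesEnat /= pS; have /andP[lt ge] := trunc_num_bounds R n p0 d0.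
  by rewrite (ltW lt) andbT lerBlDr exprVn -[X in _ + X]mul1r -mulrDl natr1.
Qed.

(** Uniqueness of digits is bypassed: for whatever expansion [digits] selects, the truncation is
    some m / p^L with 0 < 2/d - m / p^L <= p^-L, which forces m. *)
Lemma truncationE (R : realType) (p d L : nat) : (1 < p)%N -> (1 < d)%N ->
  truncation p L (2 / d%:R) = (trunc_num p d L)%:R / p%:R ^+ L :> R.
Proof.
move=> p1 d1; have p0 : (0 < p)%N by apply: ltnW.
have d0 : (0 < d)%N by apply: ltnW.
have ex : nonterminating_expansion p (2 / d%:R : R) (digits p (2 / d%:R : R)).
  rewrite /digits; set A := [set a | _]%classic.
  have exA : exists a, A a.
    by exists (fun i => trunc_num p d i.+1 - p * trunc_num p d i)%N;
      apply: trunc_num_nonterminating.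
  exact: (xgetPex _ exA).
have /= := expansion_trunc L p0 ex; rewrite -/(truncation p L (2 / d%:R)).
have [m ->] : exists m : nat, truncation p L (2 / d%:R) = m%:R / p%:R ^+ L :> R.
  rewrite /truncation; move: (digits p _) => a {ex}.
  elim: L => [|L [m mE]]; first by exists 0%N; rewrite big_ord0 mul0r.
  exists (m * p + a L)%N; rewrite big_ord_recr /= mE natrD mulrDl natrM exprSr.
  by rewrite -mulf_div divff ?mulr1 // pnatr_eq0 -lt0n.
have p0R : 0 < p%:R ^+ L :> R by rewrite exprn_gt0 // ltr0n.
have d0R : 0 < d%:R :> R by rewrite ltr0n.
rewrite -[X in _ + X]mul1r -mulrDl natr1.
rewrite ltr_pdivrMr // ler_pdivlMr // mulrAC ltr_pdivlMr // ler_pdivrMr //.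
rewrite -natrX -!natrM ltr_nat ler_nat ![(_ * d)%N]mulnC => /andP[lt ge].
by rewrite (trunc_num_eq lt ge).
Qed.

(** * F-pure thresholds of dehomogenized forms *)

Lemma fpt_trunc_num (R : realType) (k : fieldType) (p d L : nat)
    (f : {mpoly k[2]}) (F : {poly k}) :
    p \in [pchar k] -> (2 < d)%N -> ~~ (p %| d)%N ->
    size F = d.+1 -> coprimep F F^`() ->
    (forall N q, in_xy_ideal q (f ^+ N) <-> form_in (d * N) q (F ^+ N)) ->
    ~ form_in (d * trunc_num p d L) (p ^ L) (F ^+ trunc_num p d L) ->
    form_in (d * trunc_num p d L.+1) (p ^ L.+1) (F ^+ trunc_num p d L.+1) ->
  fpt R p f = (trunc_num p d L.+1)%:R / p%:R ^+ L.+1.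
Proof.
move=> hp d3 pd sF cF fF nI yI; have p0 : (0 < p)%N := prime_gt0 (pcharf_prime hp).
have p1 : (1 < p)%N := prime_gt1 (pcharf_prime hp).
have pR n : 0 < p%:R ^+ n :> R by rewrite exprn_gt0 // ltr0n.
rewrite /fpt; set S := (X in sup X); set N := trunc_num p d L.+1 in yI *.
(* If M / p^t exceeded the bound, then N p^t < M p^(L+1), and Frobenius would carry the membership
   of f^N to f^M. *)
have Sub : ubound S (N%:R / p%:R ^+ L.+1).
  move=> _ [M [t [-> nM]]]; rewrite ler_pdivrMr // mulrAC ler_pdivlMr //.
  rewrite -!natrX -!natrM ler_nat leqNgt; apply/negP => lt; apply: nM.
  rewrite fF -(form_in_exp_pchar _ _ L.+1 _ hp) -exprM -expnD -mulnA.
  apply: form_in_exp_leq (ltnW lt) _; first by rewrite sF.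
  by rewrite mulnA exprM addnC expnD form_in_exp_pchar.
have lower s : N%:R / p%:R ^+ L.+1 - (p%:R ^+ (L.+1 + s))^-1 <= sup S.
  apply: (@le_trans _ _ ((p ^ s * N).-1%:R / p%:R ^+ (L.+1 + s))).
    rewrite lerBlDr -[X in _ + X]mul1r -mulrDl natr1 exprD invfM mulrA.
    rewrite ler_pdivlMr // mulrAC ler_pM2r ?invr_gt0 //.
    by rewrite -natrX -natrM ler_nat mulnC leqSpred.
  apply: ub_le_sup; first by exists (N%:R / p%:R ^+ L.+1).
  exists (p ^ s * N).-1, (L.+1 + s)%N; split=> //.
  by rewrite fF; apply: exp_trunc_lower.
apply/eqP; rewrite eq_le ge_sup //=; last first.
  (* [S] is nonempty: it contains 0, since 1 is not in (x, y). *)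
  exists 0, 0%N, 0%N; split; first by rewrite mul0r.
  rewrite fF muln0 => /(_ 0%N isT isT) /eqP; by rewrite coef1 oner_eq0.
rewrite leNgt; apply/negP; rewrite -subr_gt0; set e := _ - _ => e0.
(* Chosen so that p^-(L+1+s) is smaller than the supposed defect [e], against [lower s]. *)
pose s := Num.bound e^-1.
have := lower s; rewrite lerBlDr -lerBlDl -/e => es.
have : e^-1 < p%:R ^+ (L.+1 + s).
  apply: lt_le_trans (archi_boundP _) _; first by rewrite invr_ge0 ltW.
  rewrite -natrX ler_nat; apply: leq_trans (ltnW (ltn_expl _ p1)) _.
  by rewrite leq_exp2l // leq_addl.
by rewrite -[X in _ < X]invrK ltf_pV2 ?posrE ?invr_gt0 // ltNge es.
Qed.

(** * Passing between binary forms and univariate polynomials *)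

Definition dehom (k : fieldType) : {mpoly k[2]} -> {poly k} :=
  mmap polyC (fun i => if i == 0 then 'X else 1).

Definition mono2 (i j : nat) : 'X_{1..2} := (U_(0%R) *+ i + U_(1%R) *+ j)%MM.

Lemma mono2E0 (i j : nat) : mono2 i j 0%R = i.
Proof. by rewrite mnmDE !mulmnE !mnmE /= mul1n mul0n addn0. Qed.

Lemma mono2E1 (i j : nat) : mono2 i j 1%R = j.
Proof. by rewrite mnmDE !mulmnE !mnmE /= mul1n mul0n add0n. Qed.

Lemma mdeg2 (m : 'X_{1..2}) : mdeg m = (m 0%R + m 1%R)%N.
Proof.
rewrite mdegE big_ord_recl big_ord1; congr (_ + m _)%N; exact: val_inj.
Qed.

Lemma mono2_eq (m m' : 'X_{1..2}) : m 0%R = m' 0%R -> m 1%R = m' 1%R -> m = m'.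
Proof.
move=> h0 h1; apply/mnmP => -[[|[|i]] Hi] //.
  by rewrite (_ : Ordinal Hi = 0%R) //; apply: val_inj.
by rewrite (_ : Ordinal Hi = 1%R) //; apply: val_inj.
Qed.

Lemma dehomE (k : fieldType) (g : {mpoly k[2]}) :
  dehom g = \sum_(m <- msupp g) g@_m *: 'X^(m 0%R).
Proof.
apply: eq_bigr => m _; rewrite mul_polyC /mmap1 big_ord_recl big_ord1 /=.
by rewrite expr1n mulr1.
Qed.

Lemma dehomM (k : fieldType) (g h : {mpoly k[2]}) :
  dehom (g * h) = dehom g * dehom h.
Proof. exact: rmorphM. Qed.

Lemma dehomXn (k : fieldType) (g : {mpoly k[2]}) (n : nat) :
  dehom (g ^+ n) = dehom g ^+ n.
Proof. exact: rmorphXn. Qed.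

Lemma size_dehom_leq (k : fieldType) (g : {mpoly k[2]}) :
  (size (dehom g) <= msize g)%N.
Proof.
rewrite dehomE; apply/leq_sizeP => j gj; rewrite coef_sum big_seq big1 // => m mg.
rewrite coefZ coefXn; case: eqP => [jE|_]; last by rewrite mulr0.
have := msize_mdeg_lt mg; rewrite mdeg2 -jE => /leq_trans-/(_ _ gj).
by rewrite ltnNge leq_addr.
Qed.

(** In a fixed degree the x-exponent determines the monomial, so no two terms merge at y = 1. *)
Lemma mcoeff_homog (k : fieldType) (D : nat) (g : {mpoly k[2]}) (m : 'X_{1..2}) :
  g \is D.-homog -> mdeg m = D -> g@_m = (dehom g)`_(m 0%R).
Proof.
move=> gD mD; rewrite dehomE coef_sum.
under eq_bigr => m' _ do rewrite coefZ coefXn.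
have same m' : m' \in msupp g -> m 0%R = m' 0%R -> m' = m.
  move=> /(dhomogP _ _ _ gD) /= m'D m0; apply: mono2_eq => //.
  by apply: (@addnI (m 0%R)); rewrite {1}m0 -!mdeg2 m'D mD.
have [mg|mg] := boolP (m \in msupp g).
  rewrite (bigD1_seq m) ?msupp_uniq //= eqxx mulr1 big_seq_cond big1 ?addr0 //.
  move=> m' /andP[m'g m'm]; case: eqP => [m0|_]; last by rewrite mulr0.
  by rewrite (same m') ?eqxx in m'm.
rewrite (memN_msupp_eq0 mg) big_seq big1 // => m' m'g.
case: eqP => [m0|_]; last by rewrite mulr0.
by move: mg; rewrite -(same _ m'g m0) m'g.
Qed.

Lemma in_xy_idealD (k : fieldType) (q : nat) (g h : {mpoly k[2]}) :
  in_xy_ideal q g -> in_xy_ideal q h -> in_xy_ideal q (g + h).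
Proof.
move=> [a [b ->]] [a' [b' ->]]; exists (a + a'), (b + b').
by rewrite addrACA -(mulrDl a) -(mulrDl b).
Qed.

(** The ideal is monomial, so membership is tested term by term. *)
Lemma in_xy_idealP (k : fieldType) (q : nat) (g : {mpoly k[2]}) :
  in_xy_ideal q g <->
  forall m : 'X_{1..2}, (m 0%R < q)%N -> (m 1%R < q)%N -> g@_m = 0.
Proof.
have monom0 (a : {mpoly k[2]}) (i : 'I_2) (m : 'X_{1..2}) :
    (m i < q)%N -> (a * 'X_i ^+ q)@_m = 0.
  move=> mi; rewrite mpolyXn mcoeffM big1 // => -[m1 m2] /= /eqP mE.
  rewrite mcoeffX; case: eqP => [m2E|_]; last by rewrite mulr0.
  suff : (q <= m i)%N by rewrite leqNgt mi.
  by rewrite mE -m2E mnmDE mulmnE mnmE eqxx mul1n leq_addl.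
split=> [[a [b ->]] m m0 m1|gI].
  by rewrite mcoeffD !monom0 // addr0.
have lift (m : 'X_{1..2}) (i : 'I_2) : (q <= m i)%N ->
    'X_[m] = 'X_[m - U_(i) *+ q] * 'X_i ^+ q :> {mpoly k[2]}.
  move=> qm; rewrite mpolyXn -mpolyXD submK //.
  apply/mnm_lepP => j; rewrite mulmnE mnmE.
  by case: eqP => [<-|_]; rewrite ?mul1n.
rewrite [g]mpolyE big_seq; elim/big_ind: _ => [||m mg].
- by exists 0, 0; rewrite !mul0r addr0.
- exact: in_xy_idealD.
have [m0|m0] := ltnP (m 0%R) q; last first.
  by rewrite (lift _ _ m0) scalerAl; exists (g@_m *: 'X_[m - U_(0%R) *+ q]), 0;
    rewrite mul0r addr0.
have [m1|m1] := ltnP (m 1%R) q; last first.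
  by rewrite (lift _ _ m1) scalerAl; exists 0, (g@_m *: 'X_[m - U_(1%R) *+ q]);
    rewrite mul0r add0r.
by move: mg; rewrite mcoeff_msupp gI ?eqxx.
Qed.

Definition homogenize (k : fieldType) (d : nat) (F : {poly k}) : {mpoly k[2]} :=
  \sum_(j < d.+1) F`_j *: 'X_[mono2 j (d - j)].

Lemma homogenize_homog (k : fieldType) (d : nat) (F : {poly k}) :
  homogenize d F \is d.-homog.
Proof.
apply: rpred_sum => j _; apply: rpredZ; rewrite dhomogX /= mdeg2.
by rewrite mono2E0 mono2E1 subnKC // -ltnS.
Qed.

Lemma homogenizeK (k : fieldType) (d : nat) (F : {poly k}) :
  (size F <= d.+1)%N -> dehom (homogenize d F) = F.
Proof.
move=> sF; rewrite /dehom raddf_sum /=.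
under eq_bigr => j _.
  rewrite mmapZ mmapX mul_polyC /mmap1 big_ord_recl big_ord1 /= expr1n mulr1.
  rewrite mono2E0; over.
rewrite -poly_def; apply/polyP => j; rewrite coef_poly; case: ltnP => // dj.
by rewrite nth_default // (leq_trans sF).
Qed.

Lemma in_xy_ideal_homogenize (k : fieldType) (d : nat) (F : {poly k}) (N q : nat) :
    (size F <= d.+1)%N ->
  in_xy_ideal q (homogenize d F ^+ N) <-> form_in (d * N) q (F ^+ N).
Proof.
move=> sF; have fN := dhomogMn N (homogenize_homog d F).
have fE : dehom (homogenize d F ^+ N) = F ^+ N by rewrite dehomXn homogenizeK.
rewrite in_xy_idealP; split=> [fI j jq dj|FI m m0 m1].
  have [jd|dj'] := leqP j (d * N).
    have := fI (mono2 j (d * N - j)); rewrite mono2E0 mono2E1 ltn_subLR //.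
    rewrite addnC dj => /(_ jq isT).
    have mE : mdeg (mono2 j (d * N - j)) = (d * N)%N.
      by rewrite mdeg2 mono2E0 mono2E1 subnKC.
    by rewrite (mcoeff_homog fN mE) fE mono2E0.
  apply: nth_default; apply: leq_trans dj'.
  exact: size_exp_leq.
have [mD|mD] := eqVneq (mdeg m) (d * N)%N; last exact: dhomog_nemf_coeff fN mD.
rewrite (mcoeff_homog fN mD) fE FI // -mD mdeg2 addnC ltn_add2r //.
Qed.

Lemma reduced_homogenize (k : fieldType) (d : nat) (F : {poly k}) :
  size F = d.+1 -> coprimep F F^`() -> reduced (homogenize d F).
Proof.
move=> sF cF; set f := homogenize d F.
have fK : dehom f = F by rewrite homogenizeK ?sF.
have f0 : f != 0.
  by apply: contra_eq_neq fK => ->; rewrite /dehom raddf0 eq_sym -size_poly_gt0 sF.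
have sf : msize f = d.+1.
  apply/eqP; rewrite eqn_leq -{2}sF -fK size_dehom_leq andbT msizeE.
  apply/bigmax_leqP_seq => m mf _.
  by rewrite (dhomogP _ _ _ (homogenize_homog d F) m mf).
split=> // g [g0 gU _] [h fE].
have h0 : h != 0 by apply: contraNneq f0 => h0; rewrite fE h0 mulr0.
have FE : F = dehom g ^+ 2 * dehom h by rewrite -fK fE dehomM dehomXn.
have /size_poly1P[c c0 GE] : size (dehom g) == 1%N.
  rewrite size_poly_eq1; apply: (coprimepP _ _ cF).
    by rewrite FE expr2 -mulrA dvdp_mulr.
  by rewrite FE expr2 -mulrA derivM dvdp_add ?dvdp_mulIl // dvdp_mull // dvdp_mulIl.
have sh : (d < msize h)%N.
  apply: leq_trans (size_dehom_leq h); rewrite -sF FE GE -polyC_exp mul_polyC.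
  exact: size_scale_leq.
have sg : (msize g <= 1)%N.
  move: sf; rewrite fE expr2 !msizeM ?mulf_neq0 // => sgh.
  have a0 : (0 < msize g)%N by rewrite lt0n msize_poly_eq0.
  have {}sgh : (((msize g + msize g).-1 + msize h).-1 = d.+1)%N by exact: sgh.
  by move: (msize g) (msize h) a0 sgh sh; clear; lia.
case/negP: gU; rewrite (msize1_polyC sg); apply/unitrP; exists (g@_0)^-1%:MP.
have gc : g@_0 != 0.
  by apply: contraNneq g0 => gc; rewrite (msize1_polyC sg) gc mpolyC0.
by rewrite -!mpolyCM mulVf ?mulfV // mpolyC1.
Qed.

(** * A reduced form with vanishing socle coefficient *)

(** A weak form of being a polynomial function on [V]: only restrictions to affine lines matter,
    which is enough for nonvanishing loci to meet. *)
Definition line_pol (k : fieldType) (V : lmodType k) (g : V -> k) : Prop :=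
  forall u v : V, exists P : {poly k}, forall s : k, g (u + s *: v) = P.[s].

Definition generic (k : fieldType) (V : lmodType k) (g : V -> k) : Prop :=
  line_pol g /\ exists u : V, g u != 0.

(* Restrict to a line through a nonzero of each function. *)
Lemma generic_mul (k : closedFieldType) (V : lmodType k) (g h : V -> k) :
  generic g -> generic h -> generic (fun x => g x * h x).
Proof.
move=> [gP [u gu]] [hP [w hw]]; split.
  move=> a b; have [P gE] := gP a b; have [Q hE] := hP a b.
  by exists (P * Q) => s; rewrite gE hE hornerM.
have [P gE] := gP u (w - u); have [Q hE] := hP u (w - u).
have P0 : P != 0.
  by apply: contraNneq gu => P0; have := gE 0; rewrite scale0r addr0 P0 horner0 => ->.
have Q0 : Q != 0.
  apply: contraNneq hw => Q0; have := hE 1.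
  by rewrite scale1r addrC subrK Q0 horner0 => ->.
have /closed_nonrootP[s PQs] : P * Q != 0 by rewrite mulf_neq0.
by exists (u + s *: (w - u)); rewrite gE hE -hornerM.
Qed.

Lemma generic_prod (k : closedFieldType) (V : lmodType k) (I : finType)
    (A : pred I) (g : I -> V -> k) :
  (forall i, A i -> generic (g i)) -> generic (fun x => \prod_(i | A i) g i x).
Proof.
move=> gP; have : all A [seq i <- index_enum I | A i] by apply: filter_all.
have E x : \prod_(i | A i) g i x = \prod_(i <- [seq i <- index_enum I | A i]) g i x.
  by rewrite big_filter.
rewrite (funext E); elim: [seq _ <- _ | _] => [_|i s IH /= /andP[Ai /IH IHs]].
  rewrite (_ : (fun x => _) = fun=> 1); last by apply/funext => x; rewrite big_nil.
  split; last by exists 0; exact: oner_neq0.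
  by move=> u v; exists 1 => t; rewrite hornerC.
rewrite (_ : (fun x => _) = fun x => g i x * \prod_(j <- s) g j x).
  exact: generic_mul (gP i Ai) IHs.
by apply/funext => x; rewrite big_cons.
Qed.

Lemma coef_horner_polyC (k : fieldType) (Q : {poly {poly k}}) (t : k) (m : nat) :
  (Q.[t%:P])`_m = (\poly_(j < size Q) (Q`_j)`_m).[t].
Proof.
rewrite horner_coef coef_sum horner_poly; apply: eq_bigr => j _.
by rewrite -polyC_exp coefMC.
Qed.

Lemma line_pol_coef (k : fieldType) (V : lmodType k) (A : V -> {poly k}) (m : nat) :
    (forall u v : V, exists Q : {poly {poly k}},
       forall s : k, A (u + s *: v) = Q.[s%:P]) ->
  line_pol (fun x => (A x)`_m).
Proof.
move=> AP u v; have [Q AE] := AP u v.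
by exists (\poly_(j < size Q) (Q`_j)`_m) => s; rewrite AE coef_horner_polyC.
Qed.

Definition linear_form (k : fieldType) (n : nat) (u : 'M[k]_(n, 2)) (i : 'I_n) :
  {poly k} := u i 0 *: 'X + (u i 1)%:P.

Lemma linear_form_line (k : fieldType) (n : nat) (u v : 'M[k]_(n, 2)) (i : 'I_n)
    (s : k) :
  linear_form (u + s *: v) i =
  ((linear_form u i)%:P + (linear_form v i)%:P * 'X).[s%:P].
Proof.
rewrite !hornerE /linear_form !mxE polyCD polyCM scalerDl -scalerA.
rewrite -(mul_polyC s) mulrDl [(_ *: 'X) * _]mulrC.
by rewrite [(_%:P : {poly k}) * s%:P]mulrC addrACA.
Qed.

Lemma line_pol_prod_linear (k : fieldType) (n N m : nat) (s : seq 'I_n) :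
  line_pol (fun u : 'M[k]_(n, 2) => ((\prod_(i <- s) linear_form u i) ^+ N)`_m).
Proof.
apply: line_pol_coef => u v.
exists ((\prod_(i <- s) ((linear_form u i)%:P + (linear_form v i)%:P * 'X)) ^+ N).
move=> t; rewrite horner_exp horner_prod; congr (_ ^+ _).
by apply: eq_bigr => i _; exact: linear_form_line.
Qed.

Lemma generic_det (k : fieldType) (n : nat) (i j : 'I_n) : i != j ->
  generic (fun u : 'M[k]_(n, 2) => u i 0 * u j 1 - u j 0 * u i 1).
Proof.
move=> ij; split.
  move=> u v; exists (((u i 0)%:P + v i 0 *: 'X) * ((u j 1)%:P + v j 1 *: 'X)
    - ((u j 0)%:P + v j 0 *: 'X) * ((u i 1)%:P + v i 1 *: 'X)) => s.
  by rewrite !hornerE !mxE; ring.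
exists (\matrix_(l, c) ((if c == 0 then l == i else l == j)%:R)).
by rewrite !mxE /= !eqxx [j == i]eq_sym (negPf ij) mul0r subr0 mulr1 oner_neq0.
Qed.

(** Nonvanishing keeps the i-th line different from y = 0, so its factor keeps degree 1 after
    dehomogenization. *)
Lemma generic_lead (k : fieldType) (n : nat) (i : 'I_n) :
  generic (fun u : 'M[k]_(n, 2) => u i 0).
Proof.
split; last by exists (const_mx 1); rewrite mxE oner_neq0.
by move=> u v; exists ((u i 0)%:P + v i 0 *: 'X) => s; rewrite !hornerE !mxE; ring.
Qed.

(* The matrix of the [n] linear forms x (c times), y and, if [b], x + y. *)
Definition start (k : fieldType) (n c : nat) (b : bool) : 'M[k]_(n, 2) :=
  \matrix_(i < n, j < 2)
    (if j == 0 then (i < c)%N || b && (i == n.-1 :> nat) else (c <= i)%N)%:R.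

Lemma prod_start (k : fieldType) (c m : nat) (b : bool) :
  \prod_(i < c + m + b) linear_form (start k (c + m + b) c b) i =
  'X^c * ('X + 1) ^+ b.
Proof.
pose L (i : nat) : {poly k} := ((i < c)%N || b && (i == (c + m + b).-1 :> nat))%:R *: 'X
  + ((c <= i)%N)%:R%:P.
rewrite (eq_bigr (fun i : 'I_(c + m + b) => L i)); last first.
  by move=> i _; rewrite /linear_form !mxE.
rewrite -(big_mkord xpredT L).
have X i : (i < c)%N -> L i = 'X.
  by move=> ic; rewrite /L ic leqNgt ic scale1r addr0.
have one i : (c <= i < c + m)%N -> L i = 1.
  move=> /andP[ci im]; rewrite /L ltnNge ci /= (_ : b && _ = false) ?scale0r ?add0r //.
  by apply/negP => /andP[bT /eqP iE]; move: im; rewrite iE bT addn1 /= ltnn.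
have cm : \prod_(0 <= i < c + m) L i = 'X^c.
  rewrite (big_cat_nat (n := c)) ?leq_addr //= [X in _ * X]big_nat_cond.
  rewrite [X in _ * X]big1; last by move=> i /andP[/one].
  rewrite mulr1 big_mkord (eq_bigr (fun=> 'X)); last by move=> i _; apply: X.
  by rewrite prodr_const card_ord.
case: b @L X one cm => L X one cm; last by rewrite addn0 cm mulr1.
rewrite addn1 big_nat_recr //= cm /L addn1 /= eqxx orbT leq_addr.
by rewrite scale1r.
Qed.

Lemma generic_doubled (k : fieldType) (r N m : nat) (b : bool) :
    (1 < r)%N -> (('X^r * ('X + 1) ^+ b : {poly k}) ^+ N)`_m != 0 ->
  forall j : 'I_(r + r.-1 + b), generic (fun u : 'M[k]_(r + r.-1 + b, 2) =>
    ((linear_form u j * \prod_i linear_form u i) ^+ N)`_m).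
Proof.
(* Recounting allows [start] with r - 1 copies of x, r of y and possibly x + y. Doubling an x, moved
   to position [j] by a transposition, yields x^r y^r or x^r y^r (x + y). *)
move=> r1 nz; have nE : (r + r.-1 + b = r.-1 + r + b)%N by lia.
rewrite nE => j.
split.
  have := @line_pol_prod_linear k (r.-1 + r + b) N m (j :: index_enum 'I_(r.-1 + r + b)).
  congr line_pol; apply/funext => u; by rewrite big_cons.
have z_lt : (0 < r.-1 + r + b)%N by lia.
pose z := Ordinal z_lt.
pose u0 : 'M[k]_(r.-1 + r + b, 2) := start k (r.-1 + r + b) r.-1 b.
exists (row_perm (tperm z j) u0).
have E i : linear_form (row_perm (tperm z j) u0) i = linear_form u0 (tperm z j i).
  by rewrite /linear_form !mxE.
rewrite E tpermR (eq_bigr _ (fun i _ => E i)).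
rewrite -(reindex_inj (@perm_inj _ (tperm z j)) (P := xpredT) (F := linear_form u0)).
rewrite prod_start.
have -> : linear_form u0 z = 'X.
  have r0 : (0 < r.-1)%N by lia.
  by rewrite /linear_form !mxE /= r0 leqNgt r0 /= scale1r addr0.
by rewrite mulrA -exprS prednK // ltnW.
Qed.

(** The case where the extra line is y, invisible at y = 1. It makes the leading coefficient in t
    nonzero when x - t y is the extra line. *)
Lemma generic_prod_start (k : fieldType) (r N m : nat) (b : bool) :
    (('X^r * ('X + 1) ^+ b : {poly k}) ^+ N)`_m != 0 ->
  generic (fun u : 'M[k]_(r + r.-1 + b, 2) =>
    ((\prod_i linear_form u i) ^+ N)`_m).
Proof.
move=> nz; split; first exact: line_pol_prod_linear.
by exists (start k (r + r.-1 + b) r b); rewrite prod_start.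
Qed.

Lemma exists_separable_root (k : closedFieldType) (r N m : nat) (b : bool) :
    (1 < r)%N -> (0 < N)%N -> (('X^r * ('X + 1) ^+ b : {poly k}) ^+ N)`_m != 0 ->
  exists F : {poly k},
    [/\ size F = (r.*2 + b).+1, coprimep F F^`() & (F ^+ N)`_m = 0].
Proof.
move=> r1 N0 nz; have n0 : (r + r.-1 + b).+1 = (r.*2 + b)%N by lia.
(* Four generic conditions on the lines: the root t differs from each of them, the polynomial in t
   has degree N, no line is y, and the lines are pairwise distinct. *)
have gen1 := generic_prod (A := xpredT) (fun j _ => generic_doubled r1 nz j).
have gen2 := generic_mul gen1 (generic_prod_start nz).
set n := (r + r.-1 + b)%N in n0 gen1 gen2.
have gen3 := generic_mul gen2
  (generic_prod (A := xpredT) (fun i _ => @generic_lead k n i)).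
have gen4 := generic_mul gen3
  (generic_prod (A := fun ij : 'I_n * 'I_n => ij.1 != ij.2)
    (fun ij nij => generic_det k nij)).
have [_ [u]] := gen4; rewrite !mulf_eq0 !negb_or => /andP[/andP[/andP[]]].
move=> /prodf_neq0 /= V0 W0 /prodf_neq0 /= lead0 /prodf_neq0 /= det0.
set h := \prod_i _ in V0 W0.
pose a i := - u i 1 / u i 0.
have linE i : linear_form u i = u i 0 *: ('X - (a i)%:P).
  rewrite /linear_form /a scalerBr -[X in _ - X]mul_polyC -polyCM.
  rewrite [u i 0 * _]mulrC mulfVK ?lead0 //.
  by rewrite polyCN opprK.
have ainj : injective a.
  move=> i j aij; apply/eqP; apply: contraT => /(det0 (i, j)) /=.
  move: aij; rewrite /a => /eqP; rewrite eqr_div ?lead0 // !mulNr eqr_opp => /eqP E.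
  by rewrite mulrC -E mulrC subrr eqxx.
(* The outer variable of [Q] is t, the inner one x; [C] is the coefficient of x^m as a polynomial in
   t. *)
pose Q : {poly {poly k}} := (h ^+ N)%:P * ('X - 'X%:P) ^+ N.
pose C := \poly_(j < size Q) (Q`_j)`_m.
have CE t : C.[t] = ((h * (t%:P - 'X)) ^+ N)`_m.
  by rewrite -coef_horner_polyC !hornerE exprMn.
have CN : C`_N = (h ^+ N)`_m.
  have QN : Q`_N = h ^+ N.
    have := monicP (monic_exp N (monicXsubC ('X : {poly k}))).
    by rewrite lead_coefE size_exp_XsubC /= coefCM => ->; rewrite mulr1.
  rewrite coef_poly QN; case: ltnP => // QN'.
  by have := nth_default 0 QN'; rewrite QN => ->; rewrite coef0.
have /closed_rootP[t /rootP Ct] : size C != 1%N.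
  apply: contraNneq W0 => sC; rewrite -CN nth_default // sC; exact.
(* Otherwise t y - x is proportional to some l_j, and [C] at t is a nonzero multiple of the
   coefficient in [V0]. *)
have ta : t \notin codom a.
  apply/negP => /codomP[j tE]; have /negP := V0 j isT; apply; apply/eqP.
  have -> : linear_form u j = - (u j 0)%:P * (t%:P - 'X).
    by rewrite linE tE mulNr -mulrN opprB mul_polyC.
  have -> : - (u j 0)%:P * (t%:P - 'X) * h = (- u j 0)%:P * (h * (t%:P - 'X)).
    by rewrite polyCN; ring.
  by rewrite exprMn -polyC_exp coefCM -CE Ct mulr0.
pose F : {poly k} := \prod_(z <- t :: codom a) ('X - z%:P).
exists F; split.
- by rewrite /F size_prod_XsubC /= size_codom card_ord n0.
- have : separable_poly F by rewrite separable_prod_XsubC /= ta; apply/injectiveP.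
  by rewrite unlock.
- have FE : h * (t%:P - 'X) = (- \prod_i u i 0)%:P * F.
    rewrite /F big_cons big_map big_enum /= /h.
    rewrite (eq_bigr _ (fun i _ => linE i)) scaler_prod.
    rewrite -mul_polyC polyCN; ring.
  move: Ct; rewrite CE FE exprMn -polyC_exp coefCM => /eqP.
  have /negPf al0 : \prod_i u i 0 != 0 by apply/prodf_neq0 => i _; exact: lead0.
  by rewrite mulf_eq0 expf_eq0 oppr_eq0 al0 andbF => /eqP.
Qed.

Lemma exists_vanishing (k : closedFieldType) (d N m : nat) :
    (3 < d)%N -> (0 < N)%N -> (d%:R : k) != 0 -> (d * N = m.*2)%N ->
  exists F : {poly k}, [/\ size F = d.+1, coprimep F F^`() & (F ^+ N)`_m = 0].
Proof.
move=> d3 N0 d0 dN.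
have dE := odd_double_half d; set r := d./2 in dE; set b := odd d in dE.
have r1 : (1 < r)%N by move: dE; case: (b) => /=; lia.
have [nz|/negPn/eqP z] := boolP ((('X^r * ('X + 1) ^+ b : {poly k}) ^+ N)`_m != 0).
  have [F [sF cF F0]] := exists_separable_root r1 N0 nz.
  by exists F; split; rewrite // sF addnC dE.
exists ('X^d - 1); split; first by rewrite size_XnsubC // (leq_trans _ d3).
  by have := separable_Xn_sub_1 d0; rewrite unlock.
(* Only the term with d (N - i) = m contributes; since d N = 2m, this is the middle term, with N =
   2i. *)
rewrite exprBn coef_sum big1 // => i _.
rewrite expr1n mulr1 -exprM coefMn.
have [mE|/negPf mE] := eqVneq m (d * (N - i))%N; last first.
  by rewrite -signr_odd mulr_sign; case: (odd i);
    rewrite ?coefN coefXn mE ?oppr0 mul0rn.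
rewrite -mulr_natr; suff -> : ('C(N, i)%:R : k) = 0 by rewrite mulr0.
have iN : (i <= N)%N by rewrite -ltnS.
have Ni : (N = i.*2)%N.
  have : (d * N == d * (N - i).*2)%N by rewrite dN mE doubleMr.
  by rewrite eqn_pmul2l ?(leq_trans _ d3) // => /eqP; lia.
have mr : (m = r * N + b * i)%N.
  have Nii : (N - i = i)%N by lia.
  rewrite mE Nii -[in LHS]dE mulnDl addnC; congr (_ + _)%N.
  by rewrite -doubleMl doubleMr -Ni.
(* For odd d the vanishing hypothesis says that the binomial coefficient is 0 in [k]; for even d it
   would say 1 = 0. *)
move: z; rewrite exprMn -exprM -exprM coefXnM mr ltnNge leq_addr /= addKn.
case: (b) => /=; last by move=> /eqP; rewrite !mul0n expr0 coef1 oner_eq0.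
rewrite !mul1n exprD1n; under eq_bigr => j _ do rewrite -scaler_nat.
by rewrite -(poly_def _ (fun j => 'C(N, j)%:R)) coef_poly ltnS iN.
Qed.

Theorem theorem5p6 (R : realType) (p : nat) (k : closedFieldType)
    (hp : p \in [pchar k]) (d : nat) (hd : (4 <= d)%N) (hpd : ~~ (p %| d)%N)
    (e : nat) (he : (0 < e)%N) (hde : (d %| 2 * p ^ e - 2)%N)
    (hmin : forall m : nat, (0 < m)%N -> (d %| 2 * p ^ m - 2)%N -> (e <= m)%N) :
  exists f : {mpoly k[2]},
    [/\ f \is d.-homog, reduced f &
        exists2 L : nat, (0 < L <= e)%N & fpt R p f = truncation p L (2 / d%:R)].
Proof.
have p1 : (1 < p)%N := prime_gt1 (pcharf_prime hp).
have q1 : (1 < p ^ e)%N by rewrite -(exp1n e) ltn_exp2r.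
have d0 : (d%:R : k) != 0 by rewrite -(dvdn_pcharf hp).
have /dvdnP[N NE] := hde.
have dN : (d * N = (p ^ e).-1.*2)%N by rewrite mulnC -NE; lia.
have N0 : (0 < N)%N by case: (N) dN => //; rewrite muln0; lia.
have [F [sF cF F0]] := exists_vanishing hd N0 d0 dN.
have eN : trunc_num p d e = N by apply: trunc_num_eq; rewrite ?mulnS dN; lia.
pose P s := `[< form_in (d * trunc_num p d s) (p ^ s) (F ^+ trunc_num p d s) >].
(* In degree 2q - 2 the only index tested by [form_in] is q - 1, the socle. *)
have Pe : P e.
  apply/asboolP; rewrite eN dN => j jq dj.
  by have -> : j = (p ^ e).-1 by lia.
(* At level 0 the numerator is 0, and 1 is not in (x, y); so the least level is positive. *)
have P0 : ~~ P 0%N.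
  have -> : P 0%N = `[< form_in 0 1 (1 : {poly k}) >].
    by rewrite /P /trunc_num expn0 muln1 divn_small ?muln0 // (leq_trans _ hd).
  by apply/asboolP => /(_ 0%N isT isT) /eqP; rewrite coef1 oner_eq0.
have exP : exists s, P s by exists e.
case: (ex_minnP exP) => -[|L] PL Lmin; first by rewrite PL in P0.
exists (homogenize d F); split.
- exact: homogenize_homog.
- exact: reduced_homogenize.
exists L.+1; first by rewrite /= Lmin.
rewrite truncationE //; last by apply: ltn_trans hd.
apply: (fpt_trunc_num R hp _ hpd sF cF) => //.
- exact: ltn_trans hd.
- by move=> M q; apply: in_xy_ideal_homogenize; rewrite sF.
- by move=> /asboolP /Lmin; rewrite ltnn.
- exact/asboolP.
Qed.
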